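(* The class $\mathcal{NB}$ is exactly the class $\mathcal{GP}$. That is, a finite simple graph $\Gamma$ belongs to $\mathcal{NB}$ if and only if it belongs to $\mathcal{GP}$.
   Context: A finite simple graph $\Gamma$ consists of a finite set $V(\Gamma)$ of vertices and a set $E(\Gamma)$ of (undirected) edges, with no loops and no multiple edges; $(u,v)\in E(\Gamma)$ means that $u$ and $v$ are adjacent. The eccentricity $\epsilon(v)$ of a vertex $v$ is the greatest geodesic distance between $v$ and any other vertex of $\Gamma$ (vertices in different connected components are at infinite distance). In particular, $\epsilon(v)=1$ exactly when $\Gamma$ has at least one vertex other than $v$ and $v$ is adjacent to every other vertex. $\mathcal{NB}$ is the class of all finite simple graphs $\Gamma$ for which no three distinct vertices $a,b,c\in V(\Gamma)$ satisfy $(a,b)\in E(\Gamma)$ while $(a,c)\notin E(\Gamma)$ and $(b,c)\notin E(\Gamma)$. Equivalently, $\Gamma$ does not have as an induced subgraph the graph on three vertices with exactly one edge. $\mathcal{GP}$ is the class of all finite simple graphs $\Gamma$ for which there exists a partition $P_0,P_1,\dots,P_n$ (for some $n\ge 0$) of $V(\Gamma)$, with all parts except perhaps $P_0$ nonempty, such that: (i) $P_0$ is the set of all vertices of $\Gamma$ with eccentricity one; (ii) if $v_i,v_j\in P_k$ with $k>0$, then $(v_i,v_j)\notin E(\Gamma)$; (iii) if $v_i\in P_i$ and $v_j\in P_j$ with $i\neq j$, then $(v_i,v_j)\in E(\Gamma)$. Such a partition is called a commuting partition. *)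

(* Defs.v *)
From mathcomp Require Import all_boot.

Set Implicit Arguments.
Unset Strict Implicit.
Unset Printing Implicit Defensive.

Record sgraph := SGraph {
  vertex :> finType;
  adj : rel vertex;
  adj_sym : symmetric adj;
  adj_irr : irreflexive adj
}.

Definition walk (G : sgraph) (u v : G) (n : nat) : bool :=
  [exists p : n.-tuple G, path (@adj G) u p && (last u p == v)].

Lemma connect_walk (G : sgraph) (u v : G) : connect (@adj G) u v -> exists n, walk u v n.
Proof.
move=> /connectP[p e_p ->]; exists (size p).
by apply/existsP; exists (in_tuple p); rewrite e_p eqxx.
Qed.

(* Geodesic distance; [None] stands for infinity. *)
Definition dist (G : sgraph) (u v : G) : option nat :=
  if decP (@idP (connect (@adj G) u v)) is left uv
  then Some (ex_minn (connect_walk uv)) else None.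

(* [None] stands for infinity. The vertex of a one-vertex graph gets
   eccentricity 0 (the maximum of the empty family). *)
Definition ecc (G : sgraph) (v : G) : option nat :=
  if [forall (u | u != v), dist v u != None]
  then Some (\max_(u | u != v) odflt 0 (dist v u)) else None.

Definition NB (G : sgraph) : Prop :=
  ~ exists a b c : G,
      [/\ uniq [:: a; b; c], adj a b, ~~ adj a c & ~~ adj b c].

Definition indexed_partition (T : finType) n (P : 'I_n.+1 -> {set T}) : Prop :=
  [/\ \bigcup_i P i = [set: T],
      forall i j, i != j -> [disjoint P i & P j]
    & forall i : 'I_n.+1, 0 < i -> P i != set0].

Definition commuting_partition (G : sgraph) n (P : 'I_n.+1 -> {set G}) : Prop :=
  [/\ indexed_partition P,
      P ord0 = [set v | ecc v == Some 1],
      forall (k : 'I_n.+1) (u v : G),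
        0 < k -> u \in P k -> v \in P k -> ~~ adj u v
    & forall (i j : 'I_n.+1) (u v : G),
        i != j -> u \in P i -> v \in P j -> adj u v].

Definition GP (G : sgraph) : Prop :=
  exists n (P : 'I_n.+1 -> {set G}), commuting_partition P.

(* Main.v *)
Require Import Defs.
From mathcomp Require Import all_boot.

(** In a graph of [NB], non-adjacency is transitive, hence an equivalence
    relation. Its classes on the complement of the set of vertices of
    eccentricity one are the parts of positive index. *)

(** The maximum 1 bounds the distance from [v] to [u], and a walk of length 0 would force [u = v];
    so a shortest walk is a single edge. *)
Lemma ecc1_adj {G : sgraph} {v u : G} : ecc v == Some 1 -> u != v -> adj v u.
Proof.
rewrite /ecc; case: ifP => // /forall_inP dist_fin /eqP[max1] uv.
have := @leq_bigmax_cond _ (fun u => u != v) (fun u => odflt 0 (dist v u)) _ uv.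
(* Finiteness excludes the value 0 that [odflt] gives to an infinite distance. *)
have := dist_fin u uv; rewrite max1 /dist; case: decP => // con _ /=.
case: ex_minnP => m /existsP[p /andP[pathp /eqP lastp]] _.
case: m p pathp lastp => [|[|m]] // p; first by rewrite tuple0 /= => _ vu; rewrite vu eqxx in uv.
by case/tupleP: p => x p; rewrite tuple0 /= andbT => vx <-.
Qed.

(** An edge [ab] would complete the forbidden triple. Its vertices are distinct: [a = b] makes the
    edge a loop, and [a = c] or [b = c] turns a non-edge into [ab]. *)
Lemma NB_nadj_trans {G : sgraph} : NB G -> transitive (fun u v : G => ~~ adj u v).
Proof.
move=> nb c a b ac cb; apply/negP => ab; apply: nb; exists a, b, c.
have bc : ~~ adj b c by rewrite adj_sym.
split=> //=; rewrite !inE !negb_or !andbT -andbA; apply/and3P; split; apply/eqP => e.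
- by rewrite e adj_irr in ab.
- by rewrite -e ab in cb.
- by rewrite -e ab in ac.
Qed.

(** In a forbidden triple, [c] shares a part with [a] and with [b], since distinct parts are joined.
    That part contains the edge [ab], so it is [P ord0]; but then [a] is adjacent to [c]. *)
Lemma GP_NB (G : sgraph) : GP G -> NB G.
Proof.
case=> n [P [[cov _ _] P0 indep joined]] [a [b [c [uabc ab nac nbc]]]].
have part x : exists i, x \in P i.
  by have := in_setT x; rewrite -cov => /bigcupP[i _ ?]; exists i.
have [i ai] := part a; have [j bj] := part b; have [k ck] := part c.
have eik : i = k by apply: contraNeq nac => ik; apply: joined ik ai ck.
have ejk : j = k by apply: contraNeq nbc => jk; apply: joined jk bj ck.
rewrite eik in ai; rewrite ejk in bj.
have [k0|kpos] := posnP k; last by move: (indep k a b kpos ai bj); rewrite ab.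
have ek : k = ord0 by apply: val_inj.
move: ai; rewrite ek P0 inE => /ecc1_adj univ; case/negP: nac; apply: univ.
by move: uabc; rewrite /= !inE negb_or eq_sym => /andP[/andP[_]]; rewrite eq_sym.
Qed.

Lemma NB_GP (G : sgraph) : NB G -> GP G.
Proof.
move=> nb; pose U := [set v : G | ecc v == Some 1].
pose R (u v : G) := ~~ adj u v.
have eqR : {in ~: U & &, equivalence_rel R}.
  move=> x y z _ _ _; split; first by rewrite /R adj_irr.
  move=> xy; apply/idP/idP; last exact: NB_nadj_trans nb _ _ _ xy.
  by apply: (NB_nadj_trans nb x y z); rewrite adj_sym.
pose Q := equivalence_partition R (~: U).
have partQ : partition Q (~: U) := equivalence_partitionP eqR.
have [/eqP covQ trivQ Q0] := and3P partQ.
have inQ B x : B \in Q -> x \in B -> x \in ~: U.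
  by move=> BQ xB; rewrite -covQ; apply/bigcupP; exists B.
(* This equation serves both adjacency conditions: [B = C] gives independence, [B != C] gives an
   edge. *)
have blockR B C x y : B \in Q -> C \in Q -> x \in B -> y \in C -> R x y = (B == C).
  move=> BQ CQ xB yC.
  rewrite -(pblock_equivalence_partition eqR (inQ _ _ BQ xB) (inQ _ _ CQ yC)).
  rewrite -/Q (def_pblock trivQ BQ xB); apply/idP/eqP => [yB|-> //].
  by rewrite -(def_pblock trivQ BQ yB) (def_pblock trivQ CQ yC).
(* Index 0 is reserved for [U], which may be empty; the classes are shifted up by one. *)
pose P (i : 'I_#|Q|.+1) := if unlift ord0 i is Some j then enum_val j else U.
have P0 : P ord0 = U by rewrite /P unlift_none.
have PS j : P (lift ord0 j) = enum_val j by rewrite /P liftK.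
have disjUQ (j : 'I_#|Q|) : [disjoint U & enum_val j].
  rewrite disjoint_sym disjoints_subset; apply/subsetP => x.
  exact: inQ (enum_valP j).
have joinU u v : u \in U -> v \notin U -> adj u v.
  move=> uU vU; apply: ecc1_adj; first by rewrite inE in uU.
  by apply: contraNneq vU => ->.
exists #|Q|, P; split; first split.
- apply/setP => x; rewrite inE; apply/bigcupP.
  have [xU|] := boolP (x \in U); first by exists ord0; rewrite ?P0.
  rewrite -in_setC -covQ => /bigcupP[B BQ xB].
  by exists (lift ord0 (enum_rank_in BQ B)); rewrite ?PS ?enum_rankK_in.
- move=> i j; have [i' ->|->] := unliftP ord0 i; have [j' ->|->] := unliftP ord0 j.
  + rewrite (inj_eq lift_inj) !PS => ij.
    apply: (trivIsetP trivQ); rewrite ?enum_valP //.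
    by rewrite (inj_eq enum_val_inj).
  + by rewrite P0 PS disjoint_sym.
  + by rewrite P0 PS.
  + by rewrite eqxx.
- move=> i; have [j -> _|-> //] := unliftP ord0 i; rewrite PS.
  (* An empty part would put [set0] among the blocks of the partition [Q]. *)
  by apply: contraNneq Q0 => <-; apply: enum_valP.
- exact: P0.
- move=> k u v; have [j -> _|-> //] := unliftP ord0 k; rewrite PS => uj vj.
  by have := blockR _ _ _ _ (enum_valP j) (enum_valP j) uj vj; rewrite eqxx.
(* Two classes are joined by [blockR], a class and [U] by [joinU]. *)
- move=> i j u v; have [i' ->|->] := unliftP ord0 i; have [j' ->|->] := unliftP ord0 j.
  + rewrite (inj_eq lift_inj) !PS => ij ui vj; apply: negbFE.
    by rewrite -/(R u v) (blockR _ _ _ _ (enum_valP i') (enum_valP j') ui vj)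
      (inj_eq enum_val_inj) (negbTE ij).
  + rewrite P0 PS adj_sym => _ ui vU; apply: joinU => //.
    by rewrite -in_setC (inQ _ _ (enum_valP i') ui).
  + rewrite P0 PS => _ uU vj; apply: joinU => //.
    by rewrite -in_setC (inQ _ _ (enum_valP j') vj).
  + by rewrite eqxx.
Qed.

Theorem theorem4 (G : sgraph) : NB G <-> GP G.
Proof. by split; [apply: NB_GP | apply: GP_NB]. Qed.
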